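(* There exists a constant $C>0$ with the following property. If $f\in L^{\exp}(\mathbb{R}^d)$ and $g\in L^1(\mathbb{R}^d)\cap L^\infty(\mathbb{R}^d)$, then $$\int_{\mathbb{R}^d}|f(x)\,g(x)|\,dx\le C\,\|f\|_{L^{\exp}}\,\|g\|_{L^1}\Big[\log\big(1+\|g\|_{L^\infty}\big)+\big|\log\|g\|_{L^1}\big|+1\Big].$$
   Context: $L^{\exp}(\mathbb{R}^d)$ is the Orlicz space of measurable functions $f:\mathbb{R}^d\to\mathbb{R}$ such that $\int_{\mathbb{R}^d}\psi(|f(x)|/\beta)\,dx<+\infty$ for some $\beta>0$, where $\psi(s)=e^s-1$ for $s\ge0$, with the Luxemburg norm $\|f\|_{L^{\exp}}=\inf\{\beta>0:\int_{\mathbb{R}^d}\psi(|f(x)|/\beta)\,dx\le1\}$. When $g=0$ a.e., the right-hand side is understood as $0$ (convention $0\cdot|\log0|=0$). *)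

(* Defs.v *)
From HB Require Import structures.
From mathcomp Require Import all_boot all_order all_algebra.
From mathcomp Require Import all_classical all_reals all_analysis.

Set Implicit Arguments.
Unset Strict Implicit.
Unset Printing Implicit Defensive.
Import Order.TTheory GRing.Theory Num.Theory.

Local Open Scope classical_set_scope.
Local Open Scope ring_scope.
Local Open Scope ereal_scope.

Section tuple_prod.
Context {disp} {T : measurableType disp} {n : nat}.

Definition cons_tuple (p : T * n.-tuple T) : n.+1.-tuple T :=
  [tuple of p.1 :: p.2].

Definition uncons_tuple (x : n.+1.-tuple T) : T * n.-tuple T :=
  (thead x, [tuple of behead x]).

Lemma measurable_cons_tuple : measurable_fun setT cons_tuple.
Proof. exact: measurable_cons. Qed.

Lemma measurable_uncons_tuple : measurable_fun setT uncons_tuple.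
Proof.
by apply/measurable_fun_pair; [exact: measurable_tnth|exact: measurable_behead].
Qed.

Lemma cons_tupleK : cancel cons_tuple uncons_tuple.
Proof. by case=> x t; rewrite /uncons_tuple/= theadE; congr pair; exact/val_inj. Qed.

HB.instance Definition _ := @isMeasurableFun.Build _ _ _ _ cons_tuple
  measurable_cons_tuple.

End tuple_prod.

Section measure_cons.
Context {disp} {T : measurableType disp} {R : realType} {n : nat}.
Variables (m1 : {sigma_finite_measure set T -> \bar R})
  (m2 : {sigma_finite_measure set (n.-tuple T) -> \bar R}).

Definition measure_cons : set (n.+1.-tuple T) -> \bar R :=
  pushforward (m1 \x m2) cons_tuple.

Let measure_cons0 : measure_cons set0 = 0.
Proof. exact: measure0. Qed.

Let measure_cons_ge0 A : 0 <= measure_cons A.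
Proof. exact: measure_ge0. Qed.

Let measure_cons_sigma_additive : semi_sigma_additive measure_cons.
Proof.
exact: (@measure_semi_sigma_additive _ _ _ (pushforward (m1 \x m2) cons_tuple)).
Qed.

HB.instance Definition _ := isMeasure.Build _ _ _ measure_cons
  measure_cons0 measure_cons_ge0 measure_cons_sigma_additive.

Let measure_cons_sigma_finite : sigma_finite setT measure_cons.
Proof.
have /sigma_finiteP[F [FT ndF Foo]] := sigma_finiteT m1.
have /sigma_finiteP[G [GT ndG Goo]] := sigma_finiteT m2.
have FGT : [set: T * n.-tuple T] = \bigcup_k (F k `*` G k).
  rewrite -setXTT FT GT; apply/seteqP; split => -[x y] /=.
    move=> [[i _ Fx] [j _ Gy]]; exists (maxn i j) => //; split.
      by move: x Fx; exact/subsetPset/ndF/leq_maxl.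
    by move: y Gy; exact/subsetPset/ndG/leq_maxr.
  by move=> [k _ [/= Fx Gy]]; split; exists k.
exists (fun k => uncons_tuple @^-1` (F k `*` G k)).
  by rewrite -preimage_bigcup -FGT preimage_setT.
move=> k; have [mF Fk] := Foo k; have [mG Gk] := Goo k; split.
  rewrite -[X in measurable X]setTI.
  by apply: measurable_uncons_tuple => //; exact: measurableX.
rewrite /measure_cons /pushforward -comp_preimage.
rewrite (_ : _ \o _ = id) ?preimage_id; last exact/funext/cons_tupleK.
by rewrite product_measure1E// lte_mul_pinfty// ge0_fin_numE.
Qed.

HB.instance Definition _ := @Measure_isSigmaFinite.Build _ _ _
  measure_cons measure_cons_sigma_finite.

End measure_cons.

Fixpoint measure_power {disp} {T : measurableType disp} {R : realType}
    (m : {sigma_finite_measure set T -> \bar R}) (d : nat) :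
    {sigma_finite_measure set (d.-tuple T) -> \bar R} :=
  if d is n.+1 then measure_cons m (measure_power m n) else \d_[tuple].

Lemma measure_power_box {disp} {T : measurableType disp} {R : realType}
    (m : {sigma_finite_measure set T -> \bar R}) (d : nat) (A : 'I_d -> set T) :
  (forall i, measurable (A i)) ->
  measure_power m d [set x | forall i, A i (tnth x i)] =
  \big[*%E/1]_(i < d) m (A i).
Proof.
elim: d A => [|d IHd] A mA.
  by rewrite big_ord0 /= diracE mem_set// => -[].
rewrite big_ord_recl -IHd; last by move=> i; exact: mA.
rewrite /= /measure_cons /pushforward -product_measure1E//; last first.
  rewrite (_ : mkset _ = \bigcap_(i in [set: 'I_d])
      ((@tnth _ T)^~ i @^-1` A (lift ord0 i))); last first.
    by apply/seteqP; split=> x /= H i; [move=> _; exact: H|exact: (H i I)].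
  apply: fin_bigcap_measurable => [|i _]; first exact: finite_finset.
  by rewrite -[X in measurable X]setTI; exact: measurable_tnth.
congr (_ _); apply/seteqP; split => -[x t]/=.
  move=> H; split; first exact: (H ord0).
  by move=> i; have := H (lift ord0 i); rewrite tnthS.
by move=> [Ax At] i; case: (unliftP ord0 i) => [j|] ->; rewrite ?tnthS.
Qed.

(* R^d with the sigma-algebra of Lebesgue measurable sets, obtained as the
   Caratheodory completion of the d-fold product of the Borel-Lebesgue measure;
   the carrier is convertible to d.-tuple R. *)
Definition Rd (R : realType) (d : nat) : measurableType _ :=
  caratheodory_type (measure_power (@lebesgue_measure R) d)^*%mu.

Definition lebesgue_Rd (R : realType) (d : nat) : {measure set (Rd R d) -> \bar R} :=
  @completed_measure_extension _ _ _ (measure_power (@lebesgue_measure R) d).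

Section exponential_Orlicz_space.
Context {disp} {T : measurableType disp} {R : realType}.
Variable mu : {measure set T -> \bar R}.

Definition psi (s : R) : R := expR s - 1.

Definition modular_exp (f : T -> R) (b : R) : \bar R :=
  \int[mu]_x (psi (`|f x| / b))%:E.

Definition Lexp : set (T -> R) :=
  [set f | measurable_fun setT f /\
           exists2 b : R, (0 < b)%R & modular_exp f b < +oo].

(* Extended-real valued: the infimum of the empty set is +oo, but it is finite
   on Lexp. *)
Definition luxemburg_exp (f : T -> R) : \bar R :=
  ereal_inf [set b%:E | b in [set b : R | (0 < b)%R /\ modular_exp f b <= 1]].

End exponential_Orlicz_space.

(* Main.v *)
Require Import Defs.
From mathcomp Require Import all_boot all_order all_algebra.
From mathcomp Require Import all_classical all_reals all_analysis.
From mathcomp Require Import measurable_realfun ess_sup_inf ring lra.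
Import Order.TTheory GRing.Theory Num.Theory.

(** The function [t |-> t * ln (1 + t)] dominates the convex conjugate of [psi],
    so that [s * t <= psi s + t * ln (1 + t)] for [s, t >= 0]. Writing [A] and
    [M] for the L^1 and L^oo norms of [g], apply this with [s = |f x| / b] and
    [t = |g x| / A], where [b] is admissible in the Luxemburg norm of [f], and
    integrate: the integral of [|f g|] is at most [b * A * (1 + ln (1 + M / A))],
    and [ln (1 + M / A) <= ln (1 + M) + |ln A| + 1]. The constant is 2. *)

Local Open Scope classical_set_scope.
Local Open Scope ring_scope.

Lemma psi_ge0 (R : realType) (s : R) : 0 <= s -> 0 <= psi s.
Proof. by move=> s0; rewrite /psi subr_ge0 -expR0 ler_expR. Qed.

Lemma young_psi (R : realType) (s t : R) :
  0 <= s -> 0 <= t -> s * t <= psi s + t * ln (1 + t).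
Proof.
move=> s0 t0; have t1 : 0 < 1 + t by rewrite ltr_pwDl.
have lt : ln (1 + t) <= t by rewrite le_ln1Dx// (lt_le_trans _ t0)// ltrN10.
(* The exponential lies above its tangent line at [ln (1 + t)]. *)
have := expR_ge1Dx (s - ln (1 + t)).
rewrite expRD expRN lnK ?posrE// ler_pdivlMr// /psi.
(* Multiplying out leaves the slack [s + (t - ln (1 + t))], which is nonnegative by [lt]. *)
by nra.
Qed.

(** After exponentiation, [1 + m / a <= (1 + m) * (1 + a^-1)], and both [1] and [a^-1] are at most
    [expR |ln a|]; the resulting factor 2 is absorbed by [expR 1]. *)
Lemma ln1D_div_le (R : realType) (a m : R) : 0 < a -> 0 <= m ->
  ln (1 + m / a) <= ln (1 + m) + `|ln a| + 1.
Proof.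
move=> a0 m0; have m1 : 0 < 1 + m by rewrite ltr_pwDl.
have ma1 : 0 < 1 + m / a by rewrite ltr_pwDl// divr_ge0// ltW.
rewrite -[leRHS]expRK ler_ln ?posrE ?expR_gt0// 2!expRD lnK ?posrE//.
have e2 : 2 <= expR 1 :> R by have := expR_ge1Dx (1 : R); lra.
have ea1 : 1 <= expR `|ln a| by rewrite -expR0 ler_expR.
have eaV : a^-1 <= expR `|ln a|.
  by rewrite -[leLHS]lnK ?posrE ?invr_gt0// ler_expR lnV ?posrE// -normrN ler_norm.
have aV0 : 0 < a^-1 by rewrite invr_gt0.
rewrite -mulrA (@le_trans _ _ ((1 + m) * (1 + a^-1)))//; first by nra.
by rewrite ler_pM2l//; nra.
Qed.

(** Only the [|v|] inside the logarithm is replaced by [m]: the second term stays linear in [|v|],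
    so that it integrates to a multiple of the L^1 norm. *)
Lemma young_psi_scaled (R : realType) (a b m u v : R) :
  0 < a -> 0 < b -> `|v| <= m ->
  `|u * v| <= b * a * psi (`|u| / b) + b * ln (1 + m / a) * `|v|.
Proof.
move=> a0 b0 vm; have m0 : 0 <= m := le_trans (normr_ge0 v) vm.
have u0 : 0 <= `|u| / b by rewrite divr_ge0// ltW.
have v0 : 0 <= `|v| / a by rewrite divr_ge0// ltW.
have := young_psi _ _ _ u0 v0.
rewrite -(ler_pM2l (mulr_gt0 b0 a0)).
rewrite (_ : b * a * (`|u| / b * _) = `|u * v|); last first.
  by rewrite normrM; field; rewrite !gt_eqF.
move=> /le_trans; apply; rewrite mulrDr lerD2l.
rewrite (_ : b * a * (_ * _) = b * ln (1 + `|v| / a) * `|v|); last first.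
  by field; rewrite gt_eqF.
apply: ler_wpM2r => //; rewrite ler_pM2l//.
rewrite ler_ln ?posrE ?ltr_pwDl ?divr_ge0 ?(ltW a0)//.
by rewrite lerD2l ler_pM2r ?invr_gt0.
Qed.

Local Open Scope ereal_scope.

Lemma measurable_psi (R : realType) : measurable_fun [set: R] (@psi R).
Proof. exact: measurable_funB. Qed.

Section duality.
Context d (T : measurableType d) (R : realType).
Variable mu : {measure set T -> \bar R}.
Implicit Types f g : T -> R.

Lemma Lnormy_ae_le g :
  \forall x \ae mu, `|(g x)%:E| <= 'N[mu]_+oo[EFin \o g].
Proof.
rewrite unlock; case: ifPn => [_|]; first exact: ess_sup_ge.
(* On a space of measure zero the norm is [0] by definition, and any two functions agree almost
   everywhere. *)
rewrite -leNgt => mu0.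
have /ae_eq0 : mu setT = 0 by apply/eqP; rewrite eq_le mu0 measure_ge0.
move=> /(_ _ (fun x => `|(g x)%:E|) (cst 0) measurableT).
by apply: filterS => x /= ->.
Qed.

(** Integrating [young_psi_scaled], the modular term contributes at most [b * a] and the linear term
    exactly [b * a * ln (1 + m / a)]. *)
Lemma integral_mul_le_modular f g (a b m : R) :
  measurable_fun setT f -> measurable_fun setT g ->
  (0 < a)%R -> (0 < b)%R -> (0 <= m)%R ->
  (\forall x \ae mu, (`|g x| <= m)%R) -> modular_exp mu f b <= 1 ->
  \int[mu]_x `|g x|%:E = a%:E ->
  \int[mu]_x `|f x * g x|%:E <= (b * (a * (1 + ln (1 + m / a))))%:E.
Proof.
move=> mf mg a0 b0 m0 gm fb ga.
set l := ln (1 + m / a).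
have l0 : (0 <= l)%R by rewrite ln_ge0// lerDl divr_ge0// ltW.
have ba0 : (0 <= b * a)%R by rewrite mulr_ge0// ltW.
have bl0 : (0 <= b * l)%R by rewrite mulr_ge0// ltW.
have psi0 x : (0 <= psi (`|f x| / b))%R by rewrite psi_ge0// divr_ge0// ltW.
have mpsi : measurable_fun setT (fun x => psi (`|f x| / b)).
  apply: (measurableT_comp (@measurable_psi R)).
  apply: measurable_funM => //; exact: measurableT_comp.
have mng : measurable_fun setT (fun x => `|g x|%R) by exact: measurableT_comp.
apply: (@le_trans _ _ (\int[mu]_x
    ((b * a)%:E * (psi (`|f x| / b))%:E + (b * l)%:E * `|g x|%:E))).
  apply: ae_ge0_le_integral => //.
  - by apply/measurable_EFinP/measurableT_comp => //; exact: measurable_funM.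
  - by move=> x _; rewrite adde_ge0// mule_ge0// lee_fin.
  - by apply: emeasurable_funD; apply: emeasurable_funM => //;
      exact/measurable_EFinP.
  - apply: filterS gm => x gx _.
    by rewrite -!EFinM -EFinD lee_fin; exact: young_psi_scaled.
rewrite ge0_integralD//; first last.
- by apply: emeasurable_funM => //; exact/measurable_EFinP.
- by move=> x _; rewrite mule_ge0// lee_fin.
- by apply: emeasurable_funM => //; exact/measurable_EFinP.
- by move=> x _; rewrite mule_ge0// lee_fin.
rewrite !ge0_integralZl_EFin//; try exact/measurable_EFinP; last first.
  by move=> x _; rewrite lee_fin.
rewrite ga -EFinM (_ : (b * (a * _) = b * a * 1 + b * l * a)%R); last by ring.
by rewrite EFinD leeD2r// [leRHS]EFinM lee_wpmul2l.
Qed.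

Lemma exp_Orlicz_holder f g : measurable_fun setT f ->
  g \in Lfun mu 1 -> g \in Lfun mu +oo ->
  \int[mu]_x `|f x * g x|%:E <=
  2%:E * luxemburg_exp mu f * 'N[mu]_1[EFin \o g]
       * (lne (1 + 'N[mu]_+oo[EFin \o g])
          + `| lne ('N[mu]_1[EFin \o g]) | + 1).
Proof.
move=> mf /andP[+ +] /andP[_ +]; rewrite !inE /= /finite_norm => mg g1 goo.
have g1E : 'N[mu]_1[EFin \o g] = \int[mu]_x `|g x|%:E by rewrite Lnorm1.
have := Lnorm_ge0 mu 1 (EFin \o g); rewrite le_eqVlt => /predU1P[g0|].
  rewrite -g0 mule0 mul0e.
  have gae0 : (EFin \o g) = \0 %[ae mu].
    by apply: (Lnorm_eq0_eq0 _ _ (esym g0)) => //; exact/measurable_EFinP.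
  rewrite (@ge0_ae_eq_integral _ _ _ _ _ _ (cst 0)) ?integral0//.
    by apply/measurable_EFinP/measurableT_comp => //; exact: measurable_funM.
  apply: filterS gae0 => x /= /(_ I) [->] _.
  by rewrite mulr0 normr0.
have aE : 'N[mu]_1[EFin \o g] \is a fin_num.
  by rewrite ge0_fin_numE// Lnorm_ge0.
have mE : 'N[mu]_+oo[EFin \o g] \is a fin_num.
  by rewrite ge0_fin_numE// Lnorm_ge0.
have gm := Lnormy_ae_le g; have := Lnorm_ge0 mu +oo (EFin \o g).
move: gm g1E; rewrite -(fineK aE) -(fineK mE).
move: (fine _) (fine _) => a m gm ga.
rewrite !lee_fin lte_fin => m0 a0.
have m1 : (0 < 1 + m)%R by rewrite ltr_pwDl.
rewrite -EFinD !lne_EFin// -!EFinD.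
set k := (ln (1 + m) + `|ln a| + 1)%R.
have k0 : (0 < k)%R by rewrite ltr_wpDl// addr_ge0// ln_ge0// lerDl.
have c0 : (0 < 2 * a * k)%R by rewrite !mulr_gt0.
rewrite (_ : 2%:E * _ * _ * _ = (2 * a * k)%:E * luxemburg_exp mu f); last first.
  by rewrite 2!EFinM -!muleA; congr (_ * _); rewrite muleC muleA.
(* Dividing by the positive real factor reduces the claim to a lower bound for the infimum, checked
   at each admissible [b]. *)
rewrite -lee_pdivrMl//; apply: le_ereal_inf_tmp => _ [b [b0 fb] <-].
rewrite lee_pdivrMl//.
have gm' : \forall x \ae mu, (`|g x| <= m)%R.
  by apply: filterS gm => x; rewrite lee_fin.
rewrite (le_trans (integral_mul_le_modular _ _ _ _ _ mf mg a0 b0 m0 gm' fb (esym ga)))//.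
rewrite -EFinM lee_fin -mulrA mulrC mulrA mulrC.
have := ln1D_div_le _ _ _ a0 m0; rewrite -/k => lk.
have ak := mulr_gt0 a0 b0.
(* The constant 2 comes from [1 + ln (1 + m / a) <= 1 + k <= 2 * k]. *)
have k1 : (1 <= k)%R by rewrite lerDr addr_ge0// ln_ge0// lerDl.
by nra.
Qed.

End duality.

(* C depends neither on f nor on g; the case g = 0 a.e. follows the stated
   convention, since lne 0 = -oo and 0 * +oo = 0 in \bar R. *)
Theorem proposition2p2 (R : realType) (d : nat) :
  exists2 C : R, (0 < C)%R & forall f g : Rd R d -> R,
    Lexp (lebesgue_Rd R d) f ->
    g \in Lfun (lebesgue_Rd R d) 1 ->
    g \in Lfun (lebesgue_Rd R d) +oo ->
    \int[lebesgue_Rd R d]_x `|f x * g x|%:E <=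
    C%:E * luxemburg_exp (lebesgue_Rd R d) f
         * 'N[lebesgue_Rd R d]_1[EFin \o g]
         * (lne (1 + 'N[lebesgue_Rd R d]_+oo[EFin \o g])
            + `| lne ('N[lebesgue_Rd R d]_1[EFin \o g]) | + 1).
Proof. by exists 2%R => // f g [mf _]; exact: exp_Orlicz_holder. Qed.
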